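(* Let $G$ be a non abelian subgroup of $\mathcal{H}(n,\mathbb{R})$. Then: (i) if $G\setminus\mathcal{S}_{n}\neq\emptyset$, then $G$ has no periodic orbit; moreover, if in addition $G$ is countable, then $G$ has no closed orbit; (ii) if $G\subset\mathcal{S}_{n}$, then every orbit of $G$ is minimal in $\mathbb{R}^{n}$.
   Context: Let $n\ge 1$. $\mathcal{H}(n,\mathbb{R})$ is the group (under composition) of all maps $f:\mathbb{R}^n\to\mathbb{R}^n$ of the form $f(x)=\lambda x+c$ with $\lambda\in\mathbb{R}\setminus\{0\}$, $c\in\mathbb{R}^n$. $\mathcal{S}_n$ is the subgroup of those maps with $\lambda\in\{-1,1\}$. For $v\in\mathbb{R}^n$, $G(v)=\{f(v):f\in G\}$ is the orbit of $v$. A periodic orbit is a finite orbit. A closed orbit is one that is a closed subset of $\mathbb{R}^n$. An orbit $G(v)$ is minimal in $\mathbb{R}^n$ if $\overline{G(v)}=\overline{G(w)}$ for every $w\in\overline{G(v)}$. *)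

(* Defs.v *)
From mathcomp Require Import all_boot all_order all_algebra.
From mathcomp Require Import all_classical all_reals all_analysis.
Import GRing.Theory Num.Theory numFieldNormedType.Exports.

Set Implicit Arguments.
Unset Strict Implicit.
Unset Printing Implicit Defensive.

Local Open Scope classical_set_scope.
Local Open Scope ring_scope.

Definition affine_homothety (R : realType) (n : nat) (lambda : R)
    (c : 'rV[R]_n) : 'rV[R]_n -> 'rV[R]_n :=
  fun x => lambda *: x + c.

Definition homothety_group (R : realType) (n : nat) :
    set ('rV[R]_n -> 'rV[R]_n) :=
  [set f | exists lambda c, lambda != 0 /\ f = affine_homothety lambda c].

Definition symmetry_group (R : realType) (n : nat) :
    set ('rV[R]_n -> 'rV[R]_n) :=
  [set f | exists lambda c,
    (lambda = -1 \/ lambda = 1) /\ f = affine_homothety lambda c].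

Definition is_subgroup_of (T : Type) (G H : set (T -> T)) : Prop :=
  [/\ G `<=` H,
      G id,
      forall f g, G f -> G g -> G (f \o g) &
      forall f, G f -> exists g, [/\ G g, f \o g = id & g \o f = id]].

Definition is_abelian (T : Type) (G : set (T -> T)) : Prop :=
  forall f g, G f -> G g -> f \o g = g \o f.

Definition orbit_of (T : Type) (G : set (T -> T)) (v : T) : set T :=
  [set f v | f in G].

Definition periodic_orbit (T : Type) (G : set (T -> T)) (v : T) : Prop :=
  finite_set (orbit_of G v).

Definition closed_orbit (T : topologicalType) (G : set (T -> T)) (v : T) :
    Prop :=
  closed (orbit_of G v).

Definition minimal_orbit (T : topologicalType) (G : set (T -> T)) (v : T) :
    Prop :=
  forall w, closure (orbit_of G v) w ->
    closure (orbit_of G v) = closure (orbit_of G w).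

(* Main.v *)
Require Import Defs.
From mathcomp Require Import all_boot all_order all_algebra.
From mathcomp Require Import all_classical all_reals all_analysis.
Import Order.TTheory GRing.Theory Num.Theory numFieldNormedType.Exports.

Local Open Scope classical_set_scope.
Local Open Scope ring_scope.

(** The linear parts of homotheties commute, so two homotheties [f] and [g]
that do not commute differ, after composition in the two orders, by a constant
[c != 0]: a non-abelian group of homotheties contains a nontrivial translation
[shift c] ([nonabelian_translation]). Every orbit then contains the points
[v + k c], [k] in [nat], and is infinite.

Suppose that the group also contains a homothety of ratio [l] different from
[-1] and [1]. Conjugating translations by it and by its inverse rescales them
by [l] and [l^-1], so the group contains [shift (r ^+ k *: c)] for all [k],
where [0 < r < 1] ([translation_contraction]). Natural multiples of these
arbitrarily small steps are dense in the half-line spanned by [c], so a closed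
orbit contains a whole ray [v + t c], [t >= 0] ([closed_ray]). A ray is
uncountable, because a countable set of reals is Lebesgue-negligible while
[0, 1] has measure [1], whereas an orbit of a countable group is countable.

Finally, if all ratios are [-1] or [1], the group acts by isometries. Then [w]
is a limit of points [f v] if and only if [v] is a limit of the points
[f^-1 w]: being in the orbit closure is a symmetric relation, and it is
transitive as well, which is minimality ([isometries_minimal]). *)

(** The maps [f \o g] and [g \o f] have the same ratio, hence differ by a
translation; composing with the inverse of [g \o f] exhibits this translation
as an element of the group. *)
Lemma nonabelian_translation (R : realType) (n : nat)
    (G : set ('rV[R]_n -> 'rV[R]_n)) :
  is_subgroup_of G (@homothety_group R n) -> ~ is_abelian G ->
  exists2 c, c != 0 & G (shift c).
Proof.
move=> [GH _ Gcomp Ginv] nab; apply: contrapT => noc; apply: nab => f g Gf Gg.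
have [l [a [_ fE]]] := GH _ Gf; have [m [b [_ gE]]] := GH _ Gg.
pose c := l *: b + a - (m *: a + b).
have fgE x : f (g x) = g (f x) + c.
  rewrite /c fE gE /affine_homothety !scalerDr !scalerA [m * l]mulrC.
  by rewrite -!(addrA (_ *: x)); congr (_ + _); rewrite [RHS]addrC subrK.
have [k [Gk kr _]] := Ginv _ (Gcomp _ _ Gg Gf).
have shiftE : (f \o g) \o k = shift c.
  by apply/funext => y /=; rewrite fgE -[in RHS](congr1 (@^~ y) kr).
have [c0|c0] := eqVneq c 0.
  by apply/funext => x /=; rewrite fgE c0 addr0.
by exfalso; apply: noc; exists c => //; rewrite -shiftE;
   exact: Gcomp (Gcomp _ _ Gf Gg) Gk.
Qed.

(** Conjugating by the homothety and by its inverse covers both [|l| < 1] and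
[|l| > 1] without computing the ratio of the inverse map. *)
Lemma translation_conj (R : realType) (n : nat)
    (G : set ('rV[R]_n -> 'rV[R]_n)) (l : R) (a : 'rV[R]_n) :
  is_subgroup_of G (@homothety_group R n) -> l != 0 ->
  G (affine_homothety l a) ->
  forall c, G (shift c) -> G (shift (l *: c)) /\ G (shift (l^-1 *: c)).
Proof.
move=> [_ _ Gcomp Ginv] l0 Gf c Gc.
have [g [Gg fg gf]] := Ginv _ Gf.
have fgK y : l *: g y + a = y := congr1 (@^~ y) fg.
have gfK y : g (l *: y + a) = y := congr1 (@^~ y) gf.
split.
- have <- : affine_homothety l a \o shift c \o g = shift (l *: c).
    apply/funext => y /=; rewrite /affine_homothety scalerDr addrAC.
    by rewrite fgK.
  exact: Gcomp (Gcomp _ _ Gf Gc) Gg.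
- have <- : g \o shift c \o affine_homothety l a = shift (l^-1 *: c).
    apply/funext => y /=; rewrite /affine_homothety addrAC -[RHS]gfK.
    by rewrite scalerDr scalerA divff// scale1r.
  exact: Gcomp (Gcomp _ _ Gg Gc) Gf.
Qed.

(** Conjugating twice makes the factor a square, hence positive; only
nonnegative integer multiples of the rescaled vectors are then needed to
approximate the points of a ray. *)
Lemma translation_contraction (R : realType) (n : nat)
    (G : set ('rV[R]_n -> 'rV[R]_n)) :
  is_subgroup_of G (@homothety_group R n) ->
  G `\` @symmetry_group R n !=set0 ->
  exists r : R, [/\ 0 < r, r < 1 &
    forall c, G (shift c) -> G (shift (r *: c))].
Proof.
move=> Gsub [f [Gf notS]]; have [GH _ _ _] := Gsub.
have [l [a [l0 fE]]] := GH _ Gf.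
have conj c := translation_conj _ _ _ l a Gsub l0 (eq_ind f G Gf _ fE) c.
have l2gt0 : 0 < l ^+ 2 by rewrite exprn_even_gt0// l0 orbT.
have [l2|l2|] := ltgtP (l ^+ 2) 1.
- by exists (l ^+ 2); split=> // c /conj[/conj[Gc _] _]; rewrite expr2 -scalerA.
- exists (l^-1 ^+ 2); split; rewrite ?exprVn ?invr_gt0 ?invf_lt1//.
  by move=> c /conj[_ /conj[_ Gc]]; rewrite -exprVn expr2 -scalerA.
- move/eqP; rewrite sqrf_eq1 => /orP l1; exfalso; apply: notS.
  by exists l, a; split=> //; case: l1 => /eqP ->; [right|left].
Qed.

Lemma translate_orbit (T : zmodType) (G : set (T -> T)) (v c x : T) :
  (forall f g, G f -> G g -> G (f \o g)) -> G (shift c) ->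
  orbit_of G v x -> orbit_of G v (x + c).
Proof.
by move=> Gcomp Gc [f Gf <-]; exists (shift c \o f) => //; exact: Gcomp.
Qed.

Lemma mulrn_translate (T : zmodType) (A : set T) (v c : T) (k : nat) :
  (forall x, A x -> A (x + c)) -> A v -> A (v + c *+ k).
Proof.
move=> Ac Av; elim: k => [|k IH]; first by rewrite mulr0n addr0.
by rewrite mulrSr addrA; exact: Ac.
Qed.

Lemma scale_injl (F : fieldType) (V : lmodType F) (c : V) :
  c != 0 -> injective (fun t : F => t *: c).
Proof.
move=> c0 s t /eqP; rewrite -subr_eq0 -scalerBl scaler_eq0 (negbTE c0) orbF.
by rewrite subr_eq0 => /eqP.
Qed.

Lemma infinite_translates (R : numFieldType) (V : lmodType R) (A : set V)
    (v c : V) :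
  c != 0 -> (forall x, A x -> A (x + c)) -> A v -> infinite_set A.
Proof.
move=> c0 Ac Av finA; apply: infinite_nat.
have vinj : {in [set: nat] &, injective (fun k => v + c *+ k)}.
  move=> i j _ _ /addrI; rewrite -[c *+ i]scaler_nat -[c *+ j]scaler_nat.
  move=> /(scale_injl _ _ _ c0)/eqP.
  by rewrite eqr_nat => /eqP.
rewrite -(eq_finite_set (inj_card_eq vinj)); apply: sub_finite_set finA.
by move=> _ [k _ <-]; exact: mulrn_translate.
Qed.

Lemma closureP_norm (R : realType) (V : normedModType R) (A : set V) (x : V) :
  closure A x <-> forall e : R, 0 < e -> exists2 y, A y & `|x - y| < e.
Proof.
split=> [clA e e0|H B /nbhs_ballP[e /= e0 xeB]].
  have [y [Ay xy]] := clA _ (nbhsx_ballx x e e0).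
  by exists y => //; move: xy; rewrite -ball_normE.
have [y Ay xy] := H e e0; exists y; split=> //; apply: xeB.
by rewrite -ball_normE.
Qed.

(** The point [v + t c] is within [r ^+ k * `|c|] of a point of [A]: round
[t] down to a multiple of [r ^+ k] and start from [v]. *)
Lemma closed_ray (R : realType) (V : normedModType R) (A : set V) (v c : V)
    (r : R) :
  closed A -> 0 < r -> r < 1 -> A v ->
  (forall k x, A x -> A (x + r ^+ k *: c)) ->
  forall t, 0 <= t -> A (v + t *: c).
Proof.
move=> clA r0 r1 Av Ac t t0; rewrite (closure_id A).1//.
apply/closureP_norm => e e0.
(* the [+ 1] keeps the denominator positive when [c = 0] *)
have c1 : 0 < `|c| + 1 by rewrite ltr_wpDl.
have [k rk] : exists k, r ^+ k < e / (`|c| + 1).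
  have r_to0 : (GRing.exp r : R^nat) @ \oo --> 0.
    by apply: cvg_expr; rewrite gtr0_norm.
  have [k _ /(_ k (leqnn k))] := cvgr_lt _ r_to0 _ (divr_gt0 e0 c1).
  by exists k.
have rk0 : 0 < r ^+ k by rewrite exprn_gt0.
pose m := Num.truncn (t / r ^+ k).
exists (v + (r ^+ k *: c) *+ m).
  by apply: mulrn_translate => // x; exact: Ac.
rewrite opprD addrACA subrr add0r -scaler_nat scalerA -scalerBl normrZ.
have /andP[tl tu] : m%:R * r ^+ k <= t < m.+1%:R * r ^+ k.
  by rewrite -ler_pdivlMr// -ltr_pdivrMr// truncn_itv// divr_ge0// ltW.
rewrite ger0_norm ?subr_ge0//.
have : t - m%:R * r ^+ k <= r ^+ k.
  by rewrite lerBlDl (le_trans (ltW tu))// -natr1 mulrDl mul1r.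
move: rk; rewrite ltr_pdivlMr// => rk tr.
apply: le_lt_trans (ler_wpM2r (normr_ge0 c) tr) _.
by apply: le_lt_trans rk; rewrite ler_wpM2l ?(ltW rk0)// lerDl.
Qed.

(** An enumeration of the ray would pull back to one of [[0, 1]], which has
positive Lebesgue measure. *)
Lemma uncountable_ray (R : realType) (V : lmodType R) (A : set V) (v c : V) :
  c != 0 -> (forall t : R, 0 <= t -> A (v + t *: c)) -> ~ countable A.
Proof.
move=> c0 ray /countable_injP[f finj].
have : countable `[0%R : R, 1].
  apply/countable_injP; exists (fun t => f (v + t *: c)) => s t.
  rewrite !inE /= !in_itv /= => /andP[s0 _] /andP[t0 _] /finj.
  rewrite !inE => /(_ (ray _ s0) (ray _ t0)) /addrI.
  exact: scale_injl.
move=> /countable_lebesgue_measure0; rewrite lebesgue_measure_itv /= lte_fin ltr01.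
by rewrite oppr0 adde0 => /eqP; rewrite eqe oner_eq0.
Qed.

(** An isometry [f] gives [`|w - f v| = `|f^-1 w - v|], so membership in orbit
closures is symmetric; transitivity is the triangle inequality, again
transporting one of the two distances by an isometry. *)
Lemma isometries_minimal (R : realType) (V : normedModType R)
    (G : set (V -> V)) :
  (forall f g, G f -> G g -> G (f \o g)) ->
  (forall f, G f -> exists2 g, G g & g \o f = id) ->
  (forall f, G f -> forall x y, `|f x - f y| = `|x - y|) ->
  forall v, minimal_orbit G v.
Proof.
move=> Gcomp Ginv Giso.
have sub v w : closure (orbit_of G v) w ->
    closure (orbit_of G w) `<=` closure (orbit_of G v).
  move=> /closureP_norm vw x /closureP_norm wx; apply/closureP_norm => e e0.
  have e20 : 0 < e / 2 by rewrite divr_gt0.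
  have [_ [g Gg <-] xgw] := wx _ e20; have [_ [f Gf <-] wfv] := vw _ e20.
  exists (g (f v)); first by exists (g \o f) => //; exact: Gcomp.
  rewrite (le_lt_trans (ler_distD (g w) _ _))// (splitr e) ltrD//.
  by rewrite (Giso g Gg).
move=> v w vw; apply/seteqP; split; last exact: sub.
apply: sub; apply/closureP_norm => e e0.
have /closureP_norm/(_ e e0)[_ [f Gf <-] wfv] := vw.
have [g Gg gf] := Ginv _ Gf; exists (g w); first by exists g.
by rewrite -[v](congr1 (@^~ v) gf) /= (Giso g Gg) distrC.
Qed.

Lemma symmetry_isometry (R : realType) (n : nat) (f : 'rV[R]_n -> 'rV[R]_n) :
  symmetry_group f -> forall x y, `|f x - f y| = `|x - y|.
Proof.
move=> [l [c [l1 ->]]] x y.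
rewrite /affine_homothety opprD addrACA subrr addr0 -scalerBr normrZ.
by case: l1 => ->; rewrite ?normrN normr1 mul1r.
Qed.

Theorem corollary1p3 (R : realType) (n : nat) (hn : (1 <= n)%N)
    (G : set ('rV[R]_n -> 'rV[R]_n))
    (G_sub : is_subgroup_of G (@homothety_group R n))
    (G_nonabelian : ~ is_abelian G) :
  (G `\` @symmetry_group R n !=set0 ->
     (~ exists v : 'rV[R]_n, periodic_orbit G v) /\
     (countable G -> ~ exists v : 'rV[R]_n, closed_orbit G v)) /\
  (G `<=` @symmetry_group R n ->
     forall v : 'rV[R]_n, minimal_orbit G v).
Proof.
have [_ Gid Gcomp Ginv] := G_sub.
have [c c0 Gc] := nonabelian_translation _ _ _ G_sub G_nonabelian.
have Ov v : orbit_of G v v by exists id.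
split=> [GS|GS].
  split=> [[v]|Gcount [v clv]].
    by apply: (infinite_translates _ _ _ v c c0) => // x; exact: translate_orbit.
  have [r [r0 r1 Gr]] := translation_contraction _ _ _ G_sub GS.
  have Grk k : G (shift (r ^+ k *: c)).
    by elim: k => [|k /Gr]; rewrite ?scale1r// scalerA -exprS.
  apply: (uncountable_ray _ _ (orbit_of G v) v c c0).
    apply: (closed_ray _ _ _ _ _ r) => // k x; exact: translate_orbit.
  exact: sub_countable (card_image_le _ _) Gcount.
apply: isometries_minimal => // [f /Ginv[g [Gg _ gf]]|f /GS]; first by exists g.
exact: symmetry_isometry.
Qed.
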